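(* Let $G$ be a finite group and let $a,b$ be non-negative integers with $a+b\geq d(G)$. If the swap graph $\Sigma_{a+b}(G)$ is connected, then the graph $\Gamma^*_{a,b}(G)$ is connected.
   Context: For a finite group $G$, $d(G)$ is the smallest cardinality of a generating set of $G$. For $d\geq d(G)$, the swap graph $\Sigma_d(G)$ is the graph whose vertices are the ordered generating $d$-tuples of $G$, two vertices $(x_1,\dots,x_d)$ and $(y_1,\dots,y_d)$ being adjacent if and only if they differ only by one entry. For non-negative integers $a,b$ (the order of the two indices is immaterial), $\Gamma_{a,b}(G)$ is the undirected graph, possibly with loops, whose vertices are the elements of $G^a\cup G^b$ (a disjoint union if $a\neq b$, just $G^a$ if $a=b$; $G^0$ consists of the single empty tuple), in which $(x_1,\dots,x_a)\in G^a$ and $(y_1,\dots,y_b)\in G^b$ are adjacent if and only if $\langle x_1,\dots,x_a,y_1,\dots,y_b\rangle=G$. If $a\neq b$ there are no other edges; if $a=b$ there is a loop at $x\in G^a$ exactly when the entries of $x$ generate $G$. A vertex is isolated if it is adjacent to no vertex (itself included). $\Gamma^*_{a,b}(G)$ is obtained from $\Gamma_{a,b}(G)$ by deleting the isolated vertices. *)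

(* Defs.v *)
From mathcomp Require Import all_boot all_fingroup all_solvable.

Set Implicit Arguments.
Unset Strict Implicit.
Unset Printing Implicit Defensive.

(* The graph with vertex set V whose edges are the pairs of vertices related by
   e (loops allowed). The graph without vertices is not counted as connected. *)
Definition graph_connected (T : finType) (V : {set T}) (e : rel T) : Prop :=
  V != set0 /\
  {in V &, forall x y,
     connect [rel u v | [&& u \in V, v \in V & e u v]] x y}.

Section GeneratingGraphs.

Variables (gT : finGroupType) (G : {group gT}).

Definition generates (s : seq gT) : bool := <<[set:: s]>>%g == G.

Definition swap_vertices (d : nat) : {set d.-tuple gT} :=
  [set x : d.-tuple gT | generates x].

Definition swap_adj (d : nat) (x y : d.-tuple gT) : bool :=
  #|[set i : 'I_d | tnth x i != tnth y i]| == 1%N.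

(* G^a and G^b are sets of sequences, of length a and b respectively, inside
   the finite type of sequences of length at most maxn a b. Hence their union
   is disjoint if a != b, and is just G^a if a = b. *)
Definition Gamma_vertices (a b : nat) : {set (maxn a b).-bseq gT} :=
  [set x : (maxn a b).-bseq gT |
     ((size x == a) || (size x == b)) && all (mem G) x].

Definition Gamma_adj (a b : nat) (x y : (maxn a b).-bseq gT) : bool :=
  [|| (size x == a) && (size y == b) | (size x == b) && (size y == a)]
  && generates (x ++ y).

Arguments Gamma_adj : clear implicits.

Definition Gamma_isolated (a b : nat) (x : (maxn a b).-bseq gT) : bool :=
  [forall y in Gamma_vertices a b, ~~ Gamma_adj a b x y].

Definition Gamma_star_vertices (a b : nat) : {set (maxn a b).-bseq gT} :=
  [set x in Gamma_vertices a b | ~~ Gamma_isolated x].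

Definition swap_graph_connected (d : nat) : Prop :=
  graph_connected (swap_vertices d) (@swap_adj d).

Definition Gamma_star_connected (a b : nat) : Prop :=
  graph_connected (Gamma_star_vertices a b) (Gamma_adj a b).

End GeneratingGraphs.

Arguments Gamma_adj {gT} G a b x y.

(* Main.v *)
Require Import Defs.
From mathcomp Require Import all_boot all_fingroup all_solvable.

(** Cutting a generating [(a + b)]-tuple [z] after its first [a] entries yields
    an edge [x - y] of the graph [Gamma_{a,b}(G)], and every edge arises in this
    way.  A swap changes a single entry of [z], hence only one of the two
    halves: if [y] is kept, then [x] and its replacement [x'] are both adjacent
    to [y]; if [x] is kept, there is nothing to do.  So the first halves along
    a path of the swap graph all lie in one component of [Gamma^*_{a,b}(G)]
    ([connect_first_half]).  A non-isolated vertex is an endpoint of an edge,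
    so it is the first half of a generating tuple or adjacent to one
    ([Gamma_star_first_half]), and connectedness of the swap graph makes all
    these first halves lie in the same component.  The argument does not
    distinguish the cases [a = b] and [a != b]. *)

Lemma generates_catC (gT : finGroupType) (G : {group gT}) (s t : seq gT) :
  generates G (s ++ t) = generates G (t ++ s).
Proof.
rewrite /generates; congr (<<_>>%g == _).
by apply/setP => x; rewrite !inE !mem_cat orbC.
Qed.

Lemma generates_all (gT : finGroupType) (G : {group gT}) (s : seq gT) :
  generates G s -> all (mem G) s.
Proof.
move=> /eqP <-; apply/allP => x xs /=.
by apply: mem_gen; rewrite inE.
Qed.

(** Depending on whether the index where the two tuples differ lies below [a],
    their last or their first parts agree. *)
Lemma swap_adj_halves (gT : finGroupType) (a b : nat)
    (x y : (a + b).-tuple gT) :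
  swap_adj x y -> take a x = take a y \/ drop a x = drop a y.
Proof.
move=> /cards1P[i defi].
have eq_nth k : k < a + b -> k != i -> nth 1%g x k = nth 1%g y k.
  move=> lt_k ne_k; have /setP/(_ (Ordinal lt_k)) := defi.
  rewrite !inE -val_eqE /= (negPf ne_k) => /negbFE/eqP.
  by rewrite !(tnth_nth 1%g).
case: (ltnP i a) => [lt_ia | le_ai]; [right | left].
  apply: (@eq_from_nth _ 1%g) => [|k]; rewrite !size_drop !size_tuple //.
  rewrite addKn => lt_kb; rewrite !nth_drop eq_nth ?ltn_add2l //.
  by rewrite gtn_eqF // (leq_trans lt_ia) ?leq_addr.
have le_a : a <= a + b by apply: leq_addr.
apply: (@eq_from_nth _ 1%g) => [|k].
  by rewrite !size_takel ?size_tuple.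
rewrite size_takel ?size_tuple // => lt_ka; rewrite !nth_take // eq_nth //.
  exact: leq_trans le_a.
by rewrite ltn_eqF // (leq_trans lt_ka).
Qed.

Section GammaStar.

Set Implicit Arguments.
Unset Strict Implicit.

Variables (gT : finGroupType) (G : {group gT}) (a b : nat).

Local Notation vertex := ((maxn a b).-bseq gT).

Definition star_edge : rel vertex :=
  [rel u v | [&& u \in Gamma_star_vertices G a b,
                 v \in Gamma_star_vertices G a b & Gamma_adj G a b u v]].

Definition first_half (z : seq gT) : vertex := insub_bseq _ (take a z).
Definition second_half (z : seq gT) : vertex := insub_bseq _ (drop a z).

Lemma Gamma_adj_sym : symmetric (Gamma_adj G a b).
Proof.
move=> u v; rewrite /Gamma_adj generates_catC; congr (_ && _).
by rewrite orbC [(size u == b) && _]andbC [(size u == a) && _]andbC.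
Qed.

Lemma star_edge_sym : symmetric star_edge.
Proof. by move=> u v; rewrite /star_edge /= Gamma_adj_sym andbCA. Qed.

Lemma Gamma_adj_vertex (u v : vertex) :
  Gamma_adj G a b u v -> u \in Gamma_vertices G a b.
Proof.
case/andP=> size_uv /generates_all; rewrite all_cat inE => /andP[-> _].
by rewrite andbT; case/orP: size_uv => /andP[-> _]; rewrite ?orbT.
Qed.

Lemma Gamma_adj_star (u v : vertex) :
  Gamma_adj G a b u v -> u \in Gamma_star_vertices G a b.
Proof.
move=> uv; rewrite inE (Gamma_adj_vertex uv) /Gamma_isolated negb_forall_in.
apply/exists_inP; exists v; last by rewrite negbK.
by rewrite (@Gamma_adj_vertex v u) // Gamma_adj_sym.
Qed.

Lemma Gamma_adj_star_edge (u v : vertex) :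
  Gamma_adj G a b u v -> star_edge u v.
Proof.
move=> uv; rewrite /star_edge /= uv (Gamma_adj_star uv) (@Gamma_adj_star v u) //.
by rewrite Gamma_adj_sym.
Qed.

Lemma halves_adj (z : (a + b).-tuple gT) :
  generates G z -> Gamma_adj G a b (first_half z) (second_half z).
Proof.
have size1 : size (take a z) = a by rewrite size_takel ?size_tuple ?leq_addr.
have size2 : size (drop a z) = b by rewrite size_drop size_tuple addKn.
have val1 : first_half z = take a z :> seq gT.
  by rewrite /first_half /insub_bseq insubdK // unfold_in size1 leq_maxl.
have val2 : second_half z = drop a z :> seq gT.
  by rewrite /second_half /insub_bseq insubdK // unfold_in size2 leq_maxr.
by rewrite /Gamma_adj val1 val2 size1 size2 !eqxx cat_take_drop.
Qed.

Lemma connect_swap_adj (y z : (a + b).-tuple gT) :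
    generates G y -> generates G z -> swap_adj y z ->
  connect star_edge (first_half y) (first_half z).
Proof.
move=> /halves_adj/Gamma_adj_star_edge gen_y.
move=> /halves_adj/Gamma_adj_star_edge gen_z /swap_adj_halves[eq1 | eq2].
  by rewrite /first_half eq1.
apply: (connect_trans (connect1 gen_y)).
by rewrite /second_half eq2 connect1 // star_edge_sym.
Qed.

Lemma connect_first_half (y z : (a + b).-tuple gT) :
    connect [rel u v | [&& u \in swap_vertices G (a + b),
                           v \in swap_vertices G (a + b) & swap_adj u v]] y z ->
  connect star_edge (first_half y) (first_half z).
Proof.
case/connectP=> p; elim: p y => [|x p IHp] y /= => [_ -> // | /andP[yx px] zE].
apply: connect_trans (IHp x px zE); case/and3P: yx; rewrite !inE.
exact: connect_swap_adj.
Qed.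

Lemma first_half_cat (u v : vertex) : size u = a -> first_half (u ++ v) = u.
Proof.
move=> size_u; apply/val_inj.
by rewrite /first_half take_size_cat // /insub_bseq valKd.
Qed.

(** The tuple is the concatenation of the vertex with a neighbour, in the order
    that puts an endpoint of size [a] first; if that endpoint is the neighbour,
    the edge itself is the connecting path. *)
Lemma Gamma_star_first_half (u : vertex) :
    u \in Gamma_star_vertices G a b ->
  exists2 z : (a + b).-tuple gT,
    z \in swap_vertices G (a + b) & connect star_edge u (first_half z).
Proof.
rewrite inE /Gamma_isolated negb_forall_in => /andP[_ /exists_inP[v _]].
rewrite negbK => uv; have /connect1 conn_uv := Gamma_adj_star_edge uv.
case/andP: uv => /orP[] /andP[/eqP size_u /eqP size_v] gen_uv.
  have size_z : size (u ++ v) == a + b by rewrite size_cat size_u size_v.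
  by exists (Tuple size_z); rewrite ?inE //= first_half_cat.
have size_z : size (v ++ u) == a + b by rewrite size_cat size_u size_v.
by exists (Tuple size_z); rewrite ?inE /= 1?generates_catC ?first_half_cat.
Qed.

End GammaStar.

Theorem lemma2p6 (gT : finGroupType) (G : {group gT}) (a b : nat)
    (hab : 'm(G)%g <= a + b) (hswap : swap_graph_connected G (a + b)) :
  Gamma_star_connected G a b.
Proof.
case: hswap => /set0Pn[z0 gen_z0] swap_conn; split.
  apply/set0Pn; exists (first_half a b z0); apply: Gamma_adj_star.
  by apply: halves_adj; rewrite inE in gen_z0.
move=> u v /Gamma_star_first_half[y gen_y u_y] /Gamma_star_first_half[z gen_z v_z].
apply: (connect_trans u_y); rewrite -/(@star_edge gT G a b).
apply: connect_trans (connect_first_half (swap_conn _ _ gen_y gen_z)) _.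
by rewrite (sym_connect_sym (@star_edge_sym _ _ _ _)).
Qed.
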